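(* Let $\rho\in\mathbb R$ and let $f$ satisfy assumption (B) of the context with Lipschitz constant $L_2$, and suppose $\rho<-\ln(6L_2^2)$. Suppose $y(\cdot)\in L^{2,\rho}_{\mathbb F}(\mathbb T_\infty;\mathbb R^n)$ is a solution of the backward stochastic difference equation BS$\triangle$E $(f)$ $$y_k=f(k+1,y'_{k+1},z'_{k+1}),\quad k\in\mathbb T_\infty,\qquad y'_{k+1}=\mathbb E[y_{k+1}|\mathcal F_{k-1}],\quad z'_{k+1}=\mathbb E[y_{k+1}w_k|\mathcal F_{k-1}].$$ Then $$\sum_{k=0}^\infty e^{-\rho k}\,\mathbb E\big[|y_k|^2\big]\le\mathcal C\sum_{k=0}^\infty e^{-\rho(k+1)}\,\mathbb E\big[|f(k+1,0,0)|^2\big],$$ where $\mathcal C>0$ depends only on $L_2$ and $\rho$. Furthermore, let $\bar f$ be another coefficient satisfying assumption (B) (with the same $\rho$), and suppose $\bar y(\cdot)\in L^{2,\rho}_{\mathbb F}(\mathbb T_\infty;\mathbb R^n)$ is a solution of BS$\triangle$E $(\bar f)$. Then $$\sum_{k=0}^\infty e^{-\rho k}\,\mathbb E\big[|y_k-\bar y_k|^2\big]\le\mathcal C\sum_{k=0}^\infty e^{-\rho(k+1)}\,\mathbb E\big[|f(k+1,\bar y'_{k+1},\bar z'_{k+1})-\bar f(k+1,\bar y'_{k+1},\bar z'_{k+1})|^2\big],$$ where $\bar y'_{k+1}=\mathbb E[\bar y_{k+1}|\mathcal F_{k-1}]$, $\bar z'_{k+1}=\mathbb E[\bar y_{k+1}w_k|\mathcal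 F_{k-1}]$ and $\mathcal C>0$ depends only on $L_2$ and $\rho$.
   Context: $\mathbb T_\infty=\{0,1,2,\dots\}$. $(\Omega,\mathcal F,\mathbb F,\mathbb P)$ is a complete filtered probability space carrying a real-valued martingale difference sequence $\{w_k\}_{k\in\mathbb T_\infty}$; $\mathcal F_k$ is the $\sigma$-algebra generated by $w_0,\dots,w_k$ (and a deterministic initial state) for $k\ge0$, $\mathcal F_{-1}=\{\emptyset,\Omega\}$, and $\mathbb E[w_{k+1}|\mathcal F_k]=0$, $\mathbb E[w_{k+1}^2|\mathcal F_k]=1$ for all $k\ge-1$. $L^{2,\rho}_{\mathbb F}(\mathbb T_\infty;\mathbb R^n)$ is the set of $\mathbb R^n$-valued processes $g=(g_0,g_1,\dots)$ with $g_k$ $\mathcal F_{k-1}$-measurable for every $k$ and $\mathbb E\sum_{k=0}^\infty e^{-\rho k}|g_k|^2<\infty$. Assumption (B): $f:\Omega\times\mathbb T_\infty\times\mathbb R^n\times\mathbb R^n\to\mathbb R^n$ satisfies: (i) $f(k+1,y',z')$ is $\mathcal F_{k-1}$-measurable for all $y',z'\in\mathbb R^n$, $k\in\mathbb T_\infty$; (ii) $f(\cdot,0,0)\in L^{2,\rho}_{\mathbb F}(\mathbb T_\infty;\mathbb R^n)$, so that $\sum_{k=0}^\infty e^{-\rho(k+1)}\mathbb E|f(k+1,0,0)|^2<\infty$; (iii) there is $L_2>0$ with $|f(k+1,y',z')-f(k+1,\bar y',\bar z')|\le L_2(|y'-\bar y'|+|z'-\bar z'|)$ for all $k\in\mathbb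 T_\infty$ and $y',\bar y',z',\bar z'\in\mathbb R^n$. A solution of BS$\triangle$E $(f)$ is a process $y(\cdot)\in L^{2,\rho}_{\mathbb F}(\mathbb T_\infty;\mathbb R^n)$ such that the process $k\mapsto f(k+1,y'_{k+1},z'_{k+1})$ belongs to $L^{2,\rho}_{\mathbb F}(\mathbb T_\infty;\mathbb R^n)$ and the equation holds for every $k\in\mathbb T_\infty$ (no terminal condition is imposed). *)

(* Defs.v *)
From HB Require Import structures.
From mathcomp Require Import all_boot all_order all_algebra.
From mathcomp Require Import all_classical all_reals all_analysis.
From mathcomp Require Import measurable_realfun.

Set Implicit Arguments.
Unset Strict Implicit.
Unset Printing Implicit Defensive.

Import Order.TTheory GRing.Theory Num.Theory.
Import numFieldNormedType.Exports.

Local Open Scope classical_set_scope.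
Local Open Scope ring_scope.

(* The library norm on ['rV[R]_n] is the sup norm; |.| in R^n is Euclidean. *)
Definition enorm (R : realType) (n : nat) (x : 'rV[R]_n) : R :=
  Num.sqrt (\sum_(i < n) x ord0 i ^+ 2).

Section conditional_expectation.
Context d (T : measurableType d) (R : realType) (P : probability T R).
Implicit Types (G : set (set T)) (X Y : T -> R).

(* [Y] is a version of E[X | G]. *)
Definition is_cond_exp G X Y : Prop :=
  [/\ measurable_fun [set: g_sigma_algebraType G] (Y : g_sigma_algebraType G -> R),
      P.-integrable [set: T] (EFin \o Y) &
      forall A, G.-sigma.-measurable A ->
        (\int[P]_(t in A) (Y t)%:E = \int[P]_(t in A) (X t)%:E)%E].

(* A chosen version of E[X | G]. It exists as soon as [X] is integrable and
   [G] consists of events, see [cond_expP]; the default [0] is then not used. *)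
Definition cond_exp G X : T -> R := xget (cst 0) [set Y | is_cond_exp G X Y].

Definition vcond_exp (n : nat) G (X : T -> 'rV[R]_n) (t : T) : 'rV[R]_n :=
  \row_i cond_exp G (fun s => X s ord0 i) t.

End conditional_expectation.

Section cond_exp_exists.
Context d (T : measurableType d) (R : realType) (P : probability T R).
Variables (G : set (set T)) (X : T -> R).
Hypotheses (Gm : G `<=` measurable)
  (Xint : P.-integrable [set: T] (EFin \o X)).

Local Notation TG := (g_sigma_algebraType G).

Let sGm (A : set T) : measurable (A : set TG) -> measurable A.
Proof.
move=> mA; have: <<s G >> `<=` @measurable _ T.
  by apply: smallest_sub => //; exact: sigma_algebra_measurable.
exact.
Qed.

Let tr (t : T) : TG := t.

Let mtr : measurable_fun [set: T] tr.
Proof. by move=> _ B mB; rewrite setTI; exact: sGm. Qed.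

Let trM : {mfun T >-> TG} :=
  HB.pack tr (isMeasurableFun.Build _ _ T TG tr mtr).

Let PG : probability TG R := distribution P trM.

Let nu (A : set TG) : \bar R := induced_charge Xint A.

Let nu0 : nu set0 = 0%E.
Proof. by rewrite /nu /induced_charge integral_set0. Qed.

Let nufin (A : set TG) : measurable A -> nu A \is a fin_num.
Proof. by move=> mA; exact: (@fin_num_measure _ _ _ (induced_charge Xint) A (sGm mA)). Qed.

Let nusa : semi_sigma_additive nu.
Proof.
move=> F mF tF mUF.
exact: (@charge_semi_sigma_additive _ _ _ (induced_charge Xint) F
  (fun i => sGm (mF i)) tF (sGm mUF)).
Qed.

Let nuC : {charge set TG -> \bar R} :=
  HB.pack nu (isCharge.Build _ _ _ nu nu0 nufin nusa).

Let nudom : nuC `<< PG.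
Proof.
apply/null_content_dominatesP => A mA PA0.
rewrite /= /nu /induced_charge null_set_integral//.
- exact: sGm.
- apply: (measurable_int P); apply: (integrableS _ _ _ Xint) => //; exact: sGm.
Qed.

Lemma cond_exp_exists : exists Y, is_cond_exp P G X Y.
Proof.
have fin t := Radon_Nikodym_fin_num t nudom.
have int := Radon_Nikodym_integrable nudom.
have mrn := measurable_int PG int.
set Z := Radon_Nikodym nuC PG in fin int mrn.
have mZ : measurable_fun [set: TG] (fine \o Z).
  exact: (measurableT_comp (fine_measurable measurableT) mrn).
have ZE : EFin \o (fine \o Z) = Z by apply/funext => t /=; rewrite fineK.
have ZP : P.-integrable [set: T] Z.
  apply/integrableP; split; first exact: (measurableT_comp mrn mtr).
  move/integrableP : int => [_].
  by rewrite ge0_integral_distribution//; exact: measurableT_comp.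
exists (fine \o Z); split; [exact: mZ|by rewrite ZE|move=> A mA].
have nuA := Radon_Nikodym_integral nudom mA.
rewrite [RHS]nuA; under eq_integral do rewrite fineK//.
rewrite (@integral_pushforward _ _ T TG R tr mtr P A Z)//.
by apply: (integrableS _ _ _ ZP) => //; exact: sGm.
Qed.

Lemma cond_expP : is_cond_exp P G X (cond_exp P G X).
Proof.
rewrite /cond_exp; case: xgetP => [Y -> //|/forallNP noY].
by case: noY; exact: cond_exp_exists.
Qed.

End cond_exp_exists.

Section noise_filtration.
Context d (T : measurableType d) (R : realType) (P : probability T R).
Variable w : nat -> {RV P >-> R}.

(* [past w k] is F_{k-1}, the sigma-algebra generated by w_0, ..., w_{k-1};
   thus [past w 0] is F_{-1} = {set0, setT}. *)
Definition past (k : nat) : set (set T) :=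
  g_sigma_preimage (fun i : 'I_k => w i : T -> R).

Lemma past_sub_measurable k : past k `<=` measurable.
Proof.
apply: smallest_sub; first exact: sigma_algebra_measurable.
apply: (big_ind (fun S : set (set T) => S `<=` measurable)).
- by move=> A.
- by move=> S1 S2 mS1 mS2 A [/mS1|/mS2].
- by move=> i _ A [B mB <-]; exact: (measurable_funP (w i)).
Qed.

Definition past_measurable (n k : nat) (X : T -> 'rV[R]_n) : Prop :=
  forall i, measurable_fun [set: g_sigma_algebraType (past k)]
    ((fun t => X t ord0 i) : g_sigma_algebraType (past k) -> R).

(* E[w_{k+1} | F_k] = 0 and E[w_{k+1}^2 | F_k] = 1 for all k >= -1. *)
Definition martingale_difference_noise : Prop :=
  forall k,
    [/\ P.-integrable [set: T] (EFin \o w k),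
        {ae P, forall t, cond_exp P (past k) (w k) t = 0},
        P.-integrable [set: T] (EFin \o (fun t => w k t ^+ 2)) &
        {ae P, forall t, cond_exp P (past k) (fun s => w k s ^+ 2) t = 1}].

(* The space L^{2,rho}_F(T_oo; R^n). *)
Definition L2rho (rho : R) (n : nat) (g : nat -> T -> 'rV[R]_n) : Prop :=
  (forall k, past_measurable k (g k)) /\
  (\int[P]_t \sum_(0 <= k <oo)
     (expR (- (rho * k%:R)) * enorm (g k t) ^+ 2)%:E < +oo)%E.

Section BSDeltaE.
Variables (rho : R) (n : nat).
Implicit Types f : T -> nat -> 'rV[R]_n -> 'rV[R]_n -> 'rV[R]_n.
Implicit Types y : nat -> T -> 'rV[R]_n.

Definition assumption_B (L : R) f : Prop :=
  [/\ forall k (y z : 'rV[R]_n), past_measurable k (fun t => f t k.+1 y z),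
      L2rho rho (fun k t => f t k 0 0),
      0 < L &
      forall k, {ae P, forall t, forall y z y1 z1 : 'rV[R]_n,
        enorm (f t k.+1 y z - f t k.+1 y1 z1) <=
          L * (enorm (y - y1) + enorm (z - z1))}].

(* [yprime y k] is y'_{k+1} = E[y_{k+1} | F_{k-1}] and
   [zprime y k] is z'_{k+1} = E[y_{k+1} w_k | F_{k-1}]. *)
Definition yprime y (k : nat) : T -> 'rV[R]_n :=
  vcond_exp P (past k) (y k.+1).

Definition zprime y (k : nat) : T -> 'rV[R]_n :=
  vcond_exp P (past k) (fun t => w k t *: y k.+1 t).

Definition BSDeltaE_solution f y : Prop :=
  [/\ L2rho rho y,
      L2rho rho (fun k t => f t k.+1 (yprime y k t) (zprime y k t)) &
      forall k, {ae P, forall t,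
        y k t = f t k.+1 (yprime y k t) (zprime y k t)}].

End BSDeltaE.
End noise_filtration.

(* Main.v *)
Require Import Defs.
From mathcomp Require Import all_boot all_order all_algebra.
From mathcomp Require Import all_classical all_reals all_analysis.
From mathcomp Require Import measurable_realfun lra ring.

Import Order.TTheory GRing.Theory Num.Theory.
Import numFieldNormedType.Exports.

Local Open Scope classical_set_scope.
Local Open Scope ring_scope.

(** Why the estimate holds.  Write a_k = E|y_k|^2.  The solution is compared
    with a residual h_k, which is f(k+1,0,0) for the first bound and
    f(k+1,y~',z~') - f~(k+1,y~',z~') for the stability bound against a second
    solution y~ for f~, in which case y stands for the difference y - y~.  In
    both cases the Lipschitz condition says
    |y_k - h_k| <= L (|y'_{k+1}| + |z'_{k+1}|) almost surely, hence
      |y_k|^2 <= 3 L^2 (|y'_{k+1}|^2 + |z'_{k+1}|^2) + 3 |h_k|^2.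

    Both y' = E[y_{k+1} | F_{k-1}] and z' = E[w_k y_{k+1} | F_{k-1}] are of the
    form E[W X | G] with E[W^2 | G] = 1, and such an operation does not increase
    the second moment (cond_exp_contraction: conditional Cauchy-Schwarz).
    Therefore a_k <= 6 L^2 a_{k+1} + 3 E|h_k|^2.  Multiplying by e^{-rho k} and
    summing over k gives, for S = sum_k e^{-rho k} a_k,
      S <= 6 L^2 e^rho S + 3 e^rho sum_k e^{-rho (k+1)} E|h_k|^2.
    Since S is finite and the hypothesis on rho says exactly that
    6 L^2 e^rho < 1, the first term on the right can be absorbed
    (discounted_recursion), with
    C = 3 e^rho / (1 - 6 L^2 e^rho).

    The residual of the second bound is f evaluated at random arguments, whose
    measurability would need a Caratheodory argument.  This is bypassed: the
    integral of a nonnegative function is a supremum over simple functions below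
    it, which is monotone on all nonnegative functions, and one may insert a
    measurable function between the two sides (ae_le_lower_integral). *)

(** * Conditional expectation as a contraction of second moments *)

Lemma integrable_mul_of_sqr {d} {T : measurableType d} {R : realType}
    {mu : {measure set T -> \bar R}} {W X : T -> R} :
  measurable_fun [set: T] W -> measurable_fun [set: T] X ->
  mu.-integrable [set: T] (EFin \o (fun t => W t ^+ 2)) ->
  mu.-integrable [set: T] (EFin \o (fun t => X t ^+ 2)) ->
  mu.-integrable [set: T] (EFin \o (fun t => W t * X t)).
Proof.
move=> mW mX iW2 iX2.
apply: (le_integrable measurableT _ _ (integrableD measurableT iW2 iX2)).
  by apply/measurable_EFinP; exact: measurable_funM.
move=> t _; rewrite /= lee_fin normrM [leRHS]ger0_norm ?addr_ge0 ?sqr_ge0//.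
by rewrite -(real_normK (num_real (W t))) -(real_normK (num_real (X t))); nra.
Qed.

Section conditional_expectation.
Context {d} {T : measurableType d} {R : realType} {P : probability T R}.
Context {G : set (set T)}.
Context (G_events : G `<=` measurable).

Lemma generated_measurable {A : set T} :
  G.-sigma.-measurable A -> measurable A.
Proof.
move=> mA; have : <<s G >> `<=` @measurable _ T.
  by apply: smallest_sub => //; exact: sigma_algebra_measurable.
exact.
Qed.

Lemma generated_measurable_fun {Y : T -> R} :
  measurable_fun [set: g_sigma_algebraType G]
    (Y : g_sigma_algebraType G -> R) ->
  measurable_fun [set: T] Y.
Proof.
move=> mY _ B mB; rewrite setTI.
by apply: generated_measurable; rewrite -[_ @^-1` _]setTI; exact: mY.
Qed.

Lemma is_cond_exp_linear (a b : R) {X1 X2 Y1 Y2 : T -> R} :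
  P.-integrable [set: T] (EFin \o X1) -> P.-integrable [set: T] (EFin \o X2) ->
  is_cond_exp P G X1 Y1 -> is_cond_exp P G X2 Y2 ->
  is_cond_exp P G (fun t => a * X1 t + b * X2 t)
    (fun t => a * Y1 t + b * Y2 t).
Proof.
move=> iX1 iX2 [mY1 iY1 Y1E] [mY2 iY2 Y2E]; split.
- apply: (@measurable_funD _ (g_sigma_algebraType G)).
    by apply: (@measurable_funM _ (g_sigma_algebraType G)).
  by apply: (@measurable_funM _ (g_sigma_algebraType G)).
- apply: (eq_integrable measurableT (fun t => a%:E * (Y1 t)%:E + b%:E * (Y2 t)%:E)%E) => //.
  by apply: integrableD => //; exact: integrableZl.
- have linE (X Y : T -> R) A : measurable A ->
      P.-integrable [set: T] (EFin \o X) -> P.-integrable [set: T] (EFin \o Y) ->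
      (\int[P]_(t in A) (a * X t + b * Y t)%:E =
       a%:E * \int[P]_(t in A) (X t)%:E + b%:E * \int[P]_(t in A) (Y t)%:E)%E.
    move=> mA iX iY.
    have iXA : P.-integrable A (EFin \o X) by apply: (integrableS measurableT).
    have iYA : P.-integrable A (EFin \o Y) by apply: (integrableS measurableT).
    under eq_integral do rewrite EFinD !EFinM.
    rewrite integralD//; [|exact: integrableZl..].
    by rewrite !integralZl.
  move=> A mA; have mA' := generated_measurable mA.
  by rewrite !linE// Y1E// Y2E.
Qed.

(** On the G-event Y < 0 the integral of Y equals that of X, hence is
    nonnegative; so this event is null. *)
Lemma is_cond_exp_ge0 {X Y : T -> R} :
  (forall t, 0 <= X t) -> is_cond_exp P G X Y -> {ae P, forall t, 0 <= Y t}.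
Proof.
move=> X0 [mY iY YE]; pose A := [set t | Y t < 0].
have mA : G.-sigma.-measurable A.
  rewrite (_ : A = [set: g_sigma_algebraType G] `&` Y @^-1` `]-oo, 0[).
    exact: mY.
  by rewrite setTI; apply/seteqP; split => t; rewrite /A /= in_itv.
have mA' := generated_measurable mA.
have iYA : P.-integrable A (EFin \o Y) by apply: (integrableS measurableT).
have YA0 : (\int[P]_(t in A) `|(EFin \o Y) t| = 0)%E.
  apply/eqP; rewrite eq_le integral_ge0// andbT.
  rewrite (eq_integral (fun t => - (EFin \o Y) t)%E); last first.
    by move=> t; rewrite inE => tA; rewrite /= ler0_norm ?(ltW tA).
  rewrite integralN; last exact: integrable_add_def.
  by rewrite YE// leeNl oppe0 integral_ge0// => t _; rewrite lee_fin.
have mYA := measurable_int P iYA.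
have /(ae_eq_integral_abs P mA' mYA) := YA0.
apply: filterS => t /= tA; rewrite leNgt; apply/negP => Yt0.
by have [E] := tA Yt0; rewrite E ltxx in Yt0.
Qed.

(** The discriminant inequality when the multiplier a only ranges over a
    countable set: a rational a slightly above z already violates the hypothesis
    if q < z ^+ 2. *)
Lemma sqr_le_of_rat_quadratic (z q : R) :
  (forall a : rat, 2 * ratr a * z <= ratr a ^+ 2 + q) -> z ^+ 2 <= q.
Proof.
move=> H; rewrite leNgt; apply/negP => qz.
pose e := Num.min 1 (z ^+ 2 - q).
have e0 : 0 < e by rewrite lt_min ltr01 subr_gt0.
have [a] := rat_in_itvoo (ltr_pwDr e0 (lexx z)).
rewrite in_itv /= => /andP[za az].
have := H a; set r : R := ratr a in za az *.
have e1 : e <= 1 by rewrite ge_min lexx.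
have e2 : e <= z ^+ 2 - q by rewrite ge_min lexx orbT.
nra.
Qed.

(** Conditional Cauchy-Schwarz.  Let Q = E[X^2 | G].  Conditioning
    0 <= (a W - X)^2 gives 2 a Z <= a^2 + Q almost surely for each constant a;
    as a ranges over a countable dense set this yields Z^2 <= Q almost surely,
    and Q has the same integral as X^2.  Using constants a, rather than Z itself,
    as multipliers avoids taking G-measurable factors out of a conditional
    expectation. *)
Lemma cond_exp_contraction {W X Z : T -> R} :
  measurable_fun [set: T] W -> measurable_fun [set: T] X ->
  P.-integrable [set: T] (EFin \o (fun t => W t ^+ 2)) ->
  P.-integrable [set: T] (EFin \o (fun t => X t ^+ 2)) ->
  is_cond_exp P G (fun t => W t ^+ 2) (cst 1) ->
  is_cond_exp P G (fun t => W t * X t) Z ->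
  (\int[P]_t (Z t ^+ 2)%:E <= \int[P]_t (X t ^+ 2)%:E)%E.
Proof.
move=> mW mX iW2 iX2 W1 WXZ.
have iWX := integrable_mul_of_sqr mW mX iW2 iX2.
have [Q XQ] := cond_exp_exists G_events iX2.
have quad (a : R) : {ae P, forall t, 2 * a * Z t <= a ^+ 2 + Q t}.
  have iWa : P.-integrable [set: T]
      (EFin \o (fun t => a ^+ 2 * W t ^+ 2 + (- 2 * a) * (W t * X t))).
    apply: (eq_integrable measurableT (fun t => (a ^+ 2)%:E * (W t ^+ 2)%:E
      + (- 2 * a)%:E * (W t * X t)%:E)%E) => //.
    by apply: integrableD => //; exact: integrableZl.
  have H := is_cond_exp_linear 1 1 iWa iX2
    (is_cond_exp_linear (a ^+ 2) (- 2 * a) iW2 iWX W1 WXZ) XQ.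
  have P0 := is_cond_exp_ge0 _ H.
  apply: filterS (P0 _) => [t /=|t]; first by lra.
  rewrite (_ : _ + _ = (a * W t - X t) ^+ 2) ?sqr_ge0//; ring.
(* Enumerating the rationals by their codes gives a common null set for all
   multipliers; numbers that code no rational are sent to 0. *)
have quadQ : {ae P, forall t, forall n,
    2 * ratr (odflt 0 (unpickle n)) * Z t
      <= ratr (odflt 0 (unpickle n)) ^+ 2 + Q t}.
  by apply/ae_foralln => n; exact: quad.
have Q0 := is_cond_exp_ge0 (fun t => sqr_ge0 (X t)) XQ.
have [mZ _ _] := WXZ; have [mQ iQ QE] := XQ.
have mZ' := generated_measurable_fun mZ.
have mQ' := generated_measurable_fun mQ.
apply: (@le_trans _ _ (\int[P]_t `|(Q t)%:E|)%E).
  apply: ae_ge0_le_integral => //.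
  - by move=> t _; rewrite lee_fin sqr_ge0.
  - by apply/measurable_EFinP; exact: measurable_funX.
  - by apply/measurable_EFinP; exact: measurableT_comp.
  apply: filterS quadQ => t H _; rewrite lee_fin.
  apply: le_trans (ler_norm (Q t)); apply: sqr_le_of_rat_quadratic => a.
  by have := H (pickle a); rewrite pickleK.
rewrite -QE; last exact: (@measurableT _ (g_sigma_algebraType G)).
rewrite le_eqVlt; apply/orP; left; apply/eqP; apply: ae_eq_integral => //.
- by apply/measurable_EFinP; exact: measurableT_comp.
- exact/measurable_EFinP.
- by apply: filterS Q0 => t Qt0 _ /=; rewrite ger0_norm.
Qed.

End conditional_expectation.

(** * Integral bounds by possibly non-measurable functions *)

Section lower_integral.
Context {d} {T : measurableType d} {R : realType} (mu : {measure set T -> \bar R}).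

(** Every simple function below f is also below g, so the suprema that define
    the two integrals compare for arbitrary g. *)
Lemma le_lower_integral (f g : T -> \bar R) :
  (forall t, 0 <= f t)%E -> (forall t, f t <= g t)%E ->
  (\int[mu]_t f t <= \int[mu]_t g t)%E.
Proof.
move=> f0 fg; have g0 t : (0 <= g t)%E := le_trans (f0 t) (fg t).
rewrite !ge0_integralTE//; apply: ereal_sup_le => _ [h /= hf <-].
by exists h => // t; exact: le_trans (hf t) (fg t).
Qed.

(** The additivity of the integral is applied to a measurable function h squeezed
    between (X - A) / c and g off the exceptional null set, and zero on that set;
    only monotonicity is then used to pass from h to the arbitrary g. *)
Lemma ae_le_lower_integral (X A g : T -> R) (c : R) : 0 < c ->
  (forall t, 0 <= X t) -> measurable_fun [set: T] X ->
  (forall t, 0 <= A t) -> measurable_fun [set: T] A ->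
  (forall t, 0 <= g t) ->
  {ae mu, forall t, X t <= A t + c * g t} ->
  (\int[mu]_t (X t)%:E <= \int[mu]_t (A t)%:E + c%:E * \int[mu]_t (g t)%:E)%E.
Proof.
move=> c0 X0 mX A0 mA g0 [N [mN N0 XN]].
pose h t := Num.max 0 ((X t - A t) / c) * \1_(~` N) t.
have h0 t : 0 <= h t by rewrite mulr_ge0// le_max lexx.
have mh : measurable_fun [set: T] h.
  apply: measurable_funM; last exact: measurable_indic (measurableC mN).
  apply: measurable_maxr => //; apply: measurable_funM => //.
  exact: measurable_funB.
have hg t : h t <= g t.
  rewrite /h indicE; case: (boolP (t \in ~` N)) => [|_]; last by rewrite mulr0.
  rewrite inE => tN; rewrite mulr1 ge_max g0/= ler_pdivrMr// mulrC lerBlDl.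
  by apply: contrapT => tX; apply: tN; exact: XN.
apply: (@le_trans _ _ (\int[mu]_t ((A t)%:E + (c * h t)%:E))%E).
  apply: ae_ge0_le_integral => //.
  - by move=> t _; rewrite lee_fin.
  - exact/measurable_EFinP.
  - by move=> t _; rewrite -EFinD lee_fin addr_ge0// mulr_ge0// ltW.
  - by apply/measurable_EFinP; apply: measurable_funD => //; exact: measurable_funM.
  - exists N; split => // t /= tX; apply: contrapT => tN; apply: tX => _.
    rewrite -EFinD lee_fin /h indicE mem_set// mulr1 -lerBlDl mulrC.
    by rewrite -ler_pdivrMr// le_max lexx orbT.
rewrite ge0_integralD//; last 4 first.
- by move=> t _; rewrite lee_fin.
- exact/measurable_EFinP.
- by move=> t _; rewrite lee_fin mulr_ge0// ltW.
- by apply/measurable_EFinP; exact: measurable_funM.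
apply: leeD2l; under eq_integral do rewrite EFinM.
rewrite ge0_integralZl_EFin//; last 3 first.
- by move=> t _; rewrite lee_fin.
- exact/measurable_EFinP.
- exact: ltW.
apply: lee_wpmul2l; first by rewrite lee_fin ltW.
by apply: le_lower_integral => t; rewrite lee_fin.
Qed.

End lower_integral.

(** * Discounted sums *)

(** Weighting the recursion by e^{-rho k} and summing turns a k.+1 into the
    original sum up to the factor K e^rho < 1, so that the finite sum on the left
    absorbs it. *)
Lemma discounted_recursion (R : realType) (rho K M : R) (a b : nat -> \bar R) :
  0 <= K -> K * expR rho < 1 -> 0 < M ->
  (forall k, 0 <= a k)%E -> (forall k, 0 <= b k)%E ->
  (forall k, a k <= K%:E * a k.+1 + M%:E * b k)%E ->
  (\sum_(0 <= k <oo) (expR (- (rho * k%:R)))%:E * a k < +oo)%E ->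
  (\sum_(0 <= k <oo) (expR (- (rho * k%:R)))%:E * a k <=
   (M * expR rho / (1 - K * expR rho))%:E *
     \sum_(0 <= k <oo) (expR (- (rho * k.+1%:R)))%:E * b k)%E.
Proof.
move=> K0 K1 M0 a0 b0 ab.
set S := (\sum_(0 <= k <oo) _)%E => Soo; set B := (\sum_(0 <= k <oo) _)%E.
have qa0 k : (0 <= (expR (- (rho * k%:R)))%:E * a k)%E.
  by rewrite mule_ge0// lee_fin expR_ge0.
have qb0 k : (0 <= (expR (- (rho * k.+1%:R)))%:E * b k)%E.
  by rewrite mule_ge0// lee_fin expR_ge0.
have Ke0 : 0 <= K * expR rho by rewrite mulr_ge0// expR_ge0.
have Me0 : 0 < M * expR rho by rewrite mulr_gt0// expR_gt0.
have S0 : (0 <= S)%E by exact: nneseries_ge0.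
have B0 : (0 <= B)%E by exact: nneseries_ge0.
(* The shifted series on the right is the series S without its first term. *)
have SKB : (S <= (K * expR rho)%:E * S + (M * expR rho)%:E * B)%E.
  have shift : (\sum_(0 <= k <oo) (expR (- (rho * k.+1%:R)))%:E * a k.+1 <= S)%E.
    have := @nneseries_addn R (fun k => (expR (- (rho * k%:R)))%:E * a k)%E 1 qa0.
    under eq_eseriesr do rewrite addn1; move=> ->.
    by rewrite /S nneseries_recl// leeDr.
  apply: (@le_trans _ _ (\sum_(0 <= k <oo)
    ((K * expR rho)%:E * ((expR (- (rho * k.+1%:R)))%:E * a k.+1) +
     (M * expR rho)%:E * ((expR (- (rho * k.+1%:R)))%:E * b k)))%E).
    apply: lee_nneseries => [k _ _|k _]; first exact: qa0.
    have -> : expR (- (rho * k%:R)) = expR rho * expR (- (rho * k.+1%:R)).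
      by rewrite -expRD -natr1; congr expR; ring.
    apply: (@le_trans _ _ ((expR rho * expR (- (rho * k.+1%:R)))%:E *
       (K%:E * a k.+1 + M%:E * b k))%E).
      by rewrite lee_wpmul2l// lee_fin mulr_ge0// expR_ge0.
    rewrite muleDr//; last by rewrite ge0_adde_def// inE mule_ge0// lee_fin// ltW.
    rewrite !muleA -!EFinM le_eqVlt; apply/orP; left; apply/eqP.
    by congr (_%:E * _ + _%:E * _)%E; ring.
  rewrite nneseriesD; last 2 first.
  - by move=> k _ _; rewrite mule_ge0.
  - by move=> k _ _; rewrite mule_ge0// lee_fin ltW.
  rewrite !nneseriesZl// leeD2r// lee_wpmul2l//.
have : S \is a fin_num by rewrite ge0_fin_numE.
move: SKB S0 B0 {Soo}; case: S => [s| |] //; case: B => [r| |] // + _ _ _.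
  rewrite -!EFinM -EFinD !lee_fin => sr.
  rewrite mulrAC ler_pdivlMr ?subr_gt0//; lra.
by move=> _; rewrite gt0_muley ?leey// lte_fin divr_gt0// subr_gt0.
Qed.

Lemma term_lty_of_discounted_sum (R : realType) (rho : R) (a : nat -> \bar R) :
  (forall k, 0 <= a k)%E ->
  (\sum_(0 <= k <oo) (expR (- (rho * k%:R)))%:E * a k < +oo)%E ->
  forall k, (a k < +oo)%E.
Proof.
move=> a0 aoo k; rewrite ltey; apply/eqP => ak.
move: aoo; rewrite (@nneseries_pinfty _ _ _ k)// => [j _|].
  by rewrite mule_ge0// lee_fin expR_ge0.
by rewrite ak gt0_muley// lte_fin expR_gt0.
Qed.

(** * Euclidean norms of random vectors *)

Section euclidean_norm.
Context {R : realType} {n : nat}.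
Implicit Types x y : 'rV[R]_n.

Lemma enorm_sqrE x : enorm x ^+ 2 = \sum_(i < n) x ord0 i ^+ 2.
Proof. by rewrite sqr_sqrtr// sumr_ge0// => i _; exact: sqr_ge0. Qed.

Lemma enorm_sqr_sub_le x y : enorm (x - y) ^+ 2 <= 2 * enorm x ^+ 2 + 2 * enorm y ^+ 2.
Proof.
rewrite !enorm_sqrE !mulr_sumr -big_split/=; apply: ler_sum => i _.
by rewrite !mxE; have := sqr_ge0 (x ord0 i + y ord0 i); nra.
Qed.

(** Young's inequality |x|^2 <= 3/2 |x - y|^2 + 3 |y|^2 is chosen so that,
    together with (a + b)^2 <= 2 (a^2 + b^2), the coefficient of
    a ^+ 2 + b ^+ 2 is 3 L^2; this is the 6 L^2 of the smallness condition once
    a and b have the same second moment bound. *)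
Lemma enorm_sqr_le_of_residual (L a b : R) x y :
  0 <= L -> 0 <= a -> 0 <= b -> enorm (x - y) <= L * (a + b) ->
  enorm x ^+ 2 <= 3 * L ^+ 2 * (a ^+ 2 + b ^+ 2) + 3 * enorm y ^+ 2.
Proof.
move=> L0 a0 b0 xy.
have xy2 : enorm (x - y) ^+ 2 <= 2 * L ^+ 2 * (a ^+ 2 + b ^+ 2).
  apply: (@le_trans _ _ ((L * (a + b)) ^+ 2)).
    by rewrite ler_pXn2r// nnegrE ?sqrtr_ge0// mulr_ge0// addr_ge0.
  have := sqr_ge0 (L * (a - b)); nra.
have : enorm x ^+ 2 <= 3 / 2 * enorm (x - y) ^+ 2 + 3 * enorm y ^+ 2.
  rewrite !enorm_sqrE !mulr_sumr -big_split/=; apply: ler_sum => i _.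
  rewrite !mxE; have := sqr_ge0 (x ord0 i - 3 * y ord0 i); nra.
by lra.
Qed.

End euclidean_norm.

Section random_vectors.
Context {d} {T : measurableType d} {R : realType} {P : probability T R} {n : nat}.
Implicit Types X Y : T -> 'rV[R]_n.

Lemma measurable_enorm_sqr X :
  (forall i, measurable_fun [set: T] (fun t => X t ord0 i)) ->
  measurable_fun [set: T] (fun t => enorm (X t) ^+ 2).
Proof.
move=> mX; under eq_fun do rewrite enorm_sqrE.
by apply: measurable_sum => i; exact: measurable_funX.
Qed.

Lemma expectation_enorm_sqr X :
  (forall i, measurable_fun [set: T] (fun t => X t ord0 i)) ->
  ('E_P[fun t => (enorm (X t) ^+ 2)%R] =
   \sum_(i < n) \int[P]_t (X t ord0 i ^+ 2)%:E)%E.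
Proof.
move=> mX; rewrite unlock -ge0_integral_sum//.
- by apply: eq_integral => t _; rewrite enorm_sqrE sumEFin.
- by move=> i; apply/measurable_EFinP; exact: measurable_funX.
- by move=> i t _; rewrite lee_fin sqr_ge0.
Qed.

Lemma expectation_enorm_sqr_ge0 X : (0 <= 'E_P[fun t => (enorm (X t) ^+ 2)%R])%E.
Proof. by rewrite unlock; apply: integral_ge0 => t _; rewrite lee_fin sqr_ge0. Qed.

Lemma integrable_coord_sqr X i :
  (forall i, measurable_fun [set: T] (fun t => X t ord0 i)) ->
  ('E_P[fun t => (enorm (X t) ^+ 2)%R] < +oo)%E ->
  P.-integrable [set: T] (EFin \o (fun t => X t ord0 i ^+ 2)).
Proof.
move=> mX Xoo; apply/integrableP; split.
  by apply/measurable_EFinP; exact: measurable_funX.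
apply: le_lt_trans Xoo.
under eq_integral do rewrite /= ger0_norm ?sqr_ge0//.
rewrite expectation_enorm_sqr// (bigD1 i)//= leeDl// sume_ge0// => j _.
by apply: integral_ge0 => t _; rewrite lee_fin sqr_ge0.
Qed.

Lemma expectation_enorm_sqr_contraction (G : set (set T)) (W : T -> R)
    (X Z : T -> 'rV[R]_n) :
  G `<=` measurable ->
  measurable_fun [set: T] W ->
  (forall i, measurable_fun [set: T] (fun t => X t ord0 i)) ->
  P.-integrable [set: T] (EFin \o (fun t => W t ^+ 2)) ->
  is_cond_exp P G (fun t => W t ^+ 2) (cst 1) ->
  ('E_P[fun t => (enorm (X t) ^+ 2)%R] < +oo)%E ->
  (forall i, is_cond_exp P G (fun t => W t * X t ord0 i) (fun t => Z t ord0 i)) ->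
  ('E_P[fun t => (enorm (Z t) ^+ 2)%R] <= 'E_P[fun t => (enorm (X t) ^+ 2)%R])%E.
Proof.
move=> G_events mW mX iW W1 Xoo XZ.
have mZ i : measurable_fun [set: T] (fun t => Z t ord0 i).
  by have [mZ _ _] := XZ i; exact: (generated_measurable_fun G_events mZ).
rewrite !expectation_enorm_sqr//; apply: lee_sum => i _.
apply: (cond_exp_contraction G_events mW (mX i) iW _ W1 (XZ i)).
exact: integrable_coord_sqr.
Qed.

End random_vectors.

(** * The backward equation *)

Section backward_equation.
Context {d} {T : measurableType d} {R : realType} {P : probability T R}.
Context {w : nat -> {RV P >-> R}}.
Context (noise : martingale_difference_noise w).

Lemma noise_sqr_integrable k :
  P.-integrable [set: T] (EFin \o (fun t => w k t ^+ 2)).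
Proof. by have [] := noise k. Qed.

Lemma noise_sqr_cond_exp k :
  is_cond_exp P (past w k) (fun t => w k t ^+ 2) (cst 1).
Proof.
have [_ _ iw2 w21] := noise k.
have [mY iY YE] := cond_expP (past_sub_measurable (w := w) (k := k)) iw2.
split; first exact: measurable_cst.
- exact: finite_measure_integrable_cst.
- move=> A mA; rewrite -YE//.
  have mA' := generated_measurable (past_sub_measurable (w := w) (k := k)) mA.
  apply: ae_eq_integral => //.
  + exact/measurable_EFinP/measurable_cst.
  + exact/(measurable_funS measurableT)/(measurable_int P iY).
  + by apply: filterS w21 => t /= ->.
Qed.

(** The constant multiplier 1 plays for y' the part that w_k plays for z', so that
    one contraction lemma covers both. *)
Lemma one_sqr_integrable :
  P.-integrable [set: T] (EFin \o (fun t : T => (cst 1 t : R) ^+ 2)).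
Proof.
under eq_fun do rewrite /= expr1n.
exact: finite_measure_integrable_cst.
Qed.

Lemma one_sqr_cond_exp k : is_cond_exp P (past w k) (fun=> 1 ^+ 2) (cst 1).
Proof.
split; first exact: measurable_cst.
- exact: finite_measure_integrable_cst.
- by move=> A _; rewrite expr1n.
Qed.

Context {rho : R} {n : nat}.
Implicit Types y : nat -> T -> 'rV[R]_n.

Lemma L2rho_measurable {y} : L2rho w rho y ->
  forall k i, measurable_fun [set: T] (fun t => y k t ord0 i).
Proof.
move=> [my _] k i.
by apply: (generated_measurable_fun (past_sub_measurable (w := w) (k := k))); exact: my.
Qed.

Lemma L2rho_discounted_sum {y} : L2rho w rho y ->
  (\sum_(0 <= k <oo) (expR (- (rho * k%:R)))%:E *
     'E_P[fun t => (enorm (y k t) ^+ 2)%R] < +oo)%E.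
Proof.
move=> yL; have my := L2rho_measurable yL; case: (yL) => _.
rewrite integral_nneseries//; last 2 first.
- move=> k; apply/measurable_EFinP; apply: measurable_funM => //.
  exact: measurable_enorm_sqr.
- by move=> k t _; rewrite lee_fin mulr_ge0 ?expR_ge0 ?sqr_ge0.
congr (_ < _)%E; apply: eq_eseriesr => k _.
under eq_integral do rewrite EFinM.
rewrite unlock ge0_integralZl_EFin ?expR_ge0//.
- by move=> t _; rewrite lee_fin sqr_ge0.
- by apply/measurable_EFinP; exact: measurable_enorm_sqr.
Qed.

Lemma L2rho_energy_lty {y} k : L2rho w rho y ->
  ('E_P[fun t => (enorm (y k t) ^+ 2)%R] < +oo)%E.
Proof.
move=> yL; apply: (@term_lty_of_discounted_sum _ rho (fun k =>
  'E_P[fun t => (enorm (y k t) ^+ 2)%R])%E); last exact: L2rho_discounted_sum.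
by move=> j; exact: expectation_enorm_sqr_ge0.
Qed.

(** Only finiteness is at stake, so the crude factor 2 suffices. *)
Lemma L2rho_discounted_sum_sub {y x : nat -> T -> 'rV[R]_n} :
  L2rho w rho y -> L2rho w rho x ->
  (\sum_(0 <= k <oo) (expR (- (rho * k%:R)))%:E *
     'E_P[fun t => (enorm (y k t - x k t) ^+ 2)%R] < +oo)%E.
Proof.
move=> yL xL; have my := L2rho_measurable yL; have mx := L2rho_measurable xL.
have E0 := @expectation_enorm_sqr_ge0 _ T R P n.
pose e (z : nat -> T -> 'rV[R]_n) k : \bar R :=
  ((expR (- (rho * k%:R)))%:E * 'E_P[fun t => (enorm (z k t) ^+ 2)%R])%E.
have e0 z k : (0 <= e z k)%E by rewrite mule_ge0// lee_fin expR_ge0.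
apply: (@le_lt_trans _ _ (\sum_(0 <= k <oo) (2%:E * e y k + 2%:E * e x k))%E).
  apply: lee_nneseries => k _; first by move=> _; exact: (e0 (fun k t => y k t - x k t)).
  have m2 (z : nat -> T -> 'rV[R]_n) :
      (forall k i, measurable_fun [set: T] (fun t => z k t ord0 i)) ->
      measurable_fun [set: T] (EFin \o (fun t => enorm (z k t) ^+ 2)).
    by move=> mz; apply/measurable_EFinP; exact: measurable_enorm_sqr.
  rewrite /e muleCA [X in (_ + X)%E]muleCA -ge0_muleDr ?mule_ge0//.
  apply: lee_wpmul2l; first by rewrite lee_fin expR_ge0.
  rewrite unlock -!ge0_integralZl//; last 4 first.
  - exact: m2 mx.
  - by move=> t _; rewrite lee_fin sqr_ge0.
  - exact: m2 my.
  - by move=> t _; rewrite lee_fin sqr_ge0.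
  rewrite -ge0_integralD//; last 4 first.
  - by move=> t _; rewrite -EFinM lee_fin mulr_ge0// sqr_ge0.
  - by apply: emeasurable_funM => //; exact: m2 my.
  - by move=> t _; rewrite -EFinM lee_fin mulr_ge0// sqr_ge0.
  - by apply: emeasurable_funM => //; exact: m2 mx.
  apply: le_lower_integral => t; first by rewrite lee_fin sqr_ge0.
  by rewrite -!EFinM -EFinD lee_fin; exact: enorm_sqr_sub_le.
rewrite nneseriesD; [|by move=> k _ _; rewrite mule_ge0..].
rewrite !nneseriesZl//.
by apply: lte_add_pinfty; apply: lte_mul_pinfty => //; exact: L2rho_discounted_sum.
Qed.

Lemma L2rho_integrable_mul {y} (W : T -> R) k i : L2rho w rho y ->
  measurable_fun [set: T] W ->
  P.-integrable [set: T] (EFin \o (fun t => W t ^+ 2)) ->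
  P.-integrable [set: T] (EFin \o (fun t => W t * y k t ord0 i)).
Proof.
move=> yL mW iW; have my := L2rho_measurable yL k.
apply: integrable_mul_of_sqr => //.
by apply: integrable_coord_sqr => //; exact: L2rho_energy_lty.
Qed.

Lemma L2rho_integrable {y} k i : L2rho w rho y ->
  P.-integrable [set: T] (EFin \o (fun t => y k t ord0 i)).
Proof.
move=> yL; have -> : (fun t => y k t ord0 i) = (fun t => cst 1 t * y k t ord0 i).
  by apply/funext => t; rewrite mul1r.
by apply: L2rho_integrable_mul => //; exact: one_sqr_integrable.
Qed.

Lemma yprime_cond_exp {y} k i : L2rho w rho y ->
  is_cond_exp P (past w k) (fun t => y k.+1 t ord0 i)
    (fun t => yprime w y k t ord0 i).
Proof.
move=> yL; under [X in is_cond_exp _ _ _ X]eq_fun do rewrite mxE.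
by apply: cond_expP; [exact: past_sub_measurable|exact: L2rho_integrable].
Qed.

Lemma zprime_cond_exp {y} k i : L2rho w rho y ->
  is_cond_exp P (past w k) (fun t => w k t * y k.+1 t ord0 i)
    (fun t => zprime w y k t ord0 i).
Proof.
move=> yL; under [X in is_cond_exp _ _ _ X]eq_fun do rewrite mxE.
have -> : (fun s => (w k s *: y k.+1 s) ord0 i) = (fun t => w k t * y k.+1 t ord0 i).
  by apply/funext => t; rewrite mxE.
apply: cond_expP; first exact: past_sub_measurable.
by apply: L2rho_integrable_mul => //; exact: noise_sqr_integrable.
Qed.

(** The common core of both bounds: y is only required to satisfy, with residual
    h, the inequality that the Lipschitz condition yields, so that it applies to
    a solution as well as to a difference of two solutions. *)
Lemma backward_estimate (L : R) (y u v h : nat -> T -> 'rV[R]_n) :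
  0 < L -> 6 * L ^+ 2 * expR rho < 1 ->
  (forall k i, measurable_fun [set: T] (fun t => y k t ord0 i)) ->
  (\sum_(0 <= k <oo) (expR (- (rho * k%:R)))%:E *
     'E_P[fun t => (enorm (y k t) ^+ 2)%R] < +oo)%E ->
  (forall k i, is_cond_exp P (past w k) (fun t => y k.+1 t ord0 i)
    (fun t => u k t ord0 i)) ->
  (forall k i, is_cond_exp P (past w k) (fun t => w k t * y k.+1 t ord0 i)
    (fun t => v k t ord0 i)) ->
  (forall k, {ae P, forall t,
    enorm (y k t - h k t) <= L * (enorm (u k t) + enorm (v k t))}) ->
  (\sum_(0 <= k <oo) (expR (- (rho * k%:R)))%:E *
     'E_P[fun t => (enorm (y k t) ^+ 2)%R] <=
   (3 * expR rho / (1 - 6 * L ^+ 2 * expR rho))%:E *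
   \sum_(0 <= k <oo) (expR (- (rho * k.+1%:R)))%:E *
     'E_P[fun t => (enorm (h k t) ^+ 2)%R])%E.
Proof.
move=> L0 L1 my yoo yu yv yh.
have E0 := @expectation_enorm_sqr_ge0 _ T R P n.
have yk := @term_lty_of_discounted_sum _ _ _ (fun k => E0 (y k)) yoo.
apply: discounted_recursion => // [|k]; first by rewrite mulr_ge0// sqr_ge0.
have mu i : measurable_fun [set: T] (fun t => u k t ord0 i).
  have [mu _ _] := yu k i.
  exact: (generated_measurable_fun (past_sub_measurable (w := w) (k := k)) mu).
have mv i : measurable_fun [set: T] (fun t => v k t ord0 i).
  have [mv _ _] := yv k i.
  exact: (generated_measurable_fun (past_sub_measurable (w := w) (k := k)) mv).
have uy : ('E_P[fun t => (enorm (u k t) ^+ 2)%R] <=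
           'E_P[fun t => (enorm (y k.+1 t) ^+ 2)%R])%E.
  apply: (@expectation_enorm_sqr_contraction _ _ _ _ _ (past w k) (cst 1)) => //.
  - exact: past_sub_measurable.
  - exact: one_sqr_integrable.
  - exact: one_sqr_cond_exp.
  - move=> i; under [X in is_cond_exp _ _ X]eq_fun do rewrite mul1r.
    exact: yu.
have vy : ('E_P[fun t => (enorm (v k t) ^+ 2)%R] <=
           'E_P[fun t => (enorm (y k.+1 t) ^+ 2)%R])%E.
  apply: (@expectation_enorm_sqr_contraction _ _ _ _ _ (past w k) (w k)) => //.
  - exact: past_sub_measurable.
  - exact: noise_sqr_integrable.
  - exact: noise_sqr_cond_exp.
have muv : measurable_fun [set: T] (fun t => enorm (u k t) ^+ 2 + enorm (v k t) ^+ 2).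
  by apply: measurable_funD; exact: measurable_enorm_sqr.
apply: (@le_trans _ _ ((3 * L ^+ 2)%:E * ('E_P[fun t => (enorm (u k t) ^+ 2)%R] +
  'E_P[fun t => (enorm (v k t) ^+ 2)%R]) +
  3%:E * 'E_P[fun t => (enorm (h k t) ^+ 2)%R])%E).
  have -> : ((3 * L ^+ 2)%:E * ('E_P[fun t => (enorm (u k t) ^+ 2)%R] +
      'E_P[fun t => (enorm (v k t) ^+ 2)%R]) =
    \int[P]_t (3 * L ^+ 2 * (enorm (u k t) ^+ 2 + enorm (v k t) ^+ 2))%:E)%E.
    under [RHS]eq_integral do rewrite EFinM.
    rewrite [RHS]ge0_integralZl_EFin//; last 3 first.
    - by move=> t _; rewrite lee_fin addr_ge0// sqr_ge0.
    - exact/measurable_EFinP.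
    - by rewrite mulr_ge0// sqr_ge0.
    rewrite unlock; under [in RHS]eq_integral do rewrite EFinD.
    rewrite ge0_integralD//.
    - by move=> t _; rewrite lee_fin sqr_ge0.
    - by apply/measurable_EFinP; exact: measurable_enorm_sqr.
    - by move=> t _; rewrite lee_fin sqr_ge0.
    - by apply/measurable_EFinP; exact: measurable_enorm_sqr.
  rewrite unlock; apply: ae_le_lower_integral => //.
  - by move=> t; exact: sqr_ge0.
  - exact: measurable_enorm_sqr.
  - by move=> t; apply: mulr_ge0; [rewrite mulr_ge0 ?sqr_ge0|rewrite addr_ge0 ?sqr_ge0].
  - exact: measurable_funM.
  - by move=> t; exact: sqr_ge0.
  apply: filterS (yh k) => t; apply: enorm_sqr_le_of_residual => //.
  - exact: ltW.
  - exact: sqrtr_ge0.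
  - exact: sqrtr_ge0.
apply: leeD2r.
have -> : 6 * L ^+ 2 = 3 * L ^+ 2 * 2 by ring.
rewrite (EFinM _ 2) -muleA; apply: lee_wpmul2l; first by rewrite lee_fin mulr_ge0// sqr_ge0.
by rewrite mule_natl mule2n; exact: leeD.
Qed.

End backward_equation.

Theorem lemma2p2 (R : realType) (L2 rho : R) (hL2 : 0 < L2)
    (hrho : rho < - ln (6 * L2 ^+ 2)) :
  exists C : R, 0 < C /\
  forall (d : measure_display) (T : measurableType d) (P : probability T R)
    (w : nat -> {RV P >-> R}) (n : nat)
    (f : T -> nat -> 'rV[R]_n -> 'rV[R]_n -> 'rV[R]_n)
    (y : nat -> T -> 'rV[R]_n),
  measure_is_complete P ->
  martingale_difference_noise w ->
  assumption_B w rho L2 f ->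
  BSDeltaE_solution w rho f y ->
  (\sum_(0 <= k <oo) (expR (- (rho * k%:R)))%:E
       * 'E_P[fun t => (enorm (y k t) ^+ 2)%R]
   <= C%:E * \sum_(0 <= k <oo) (expR (- (rho * k.+1%:R)))%:E
       * 'E_P[fun t => (enorm (f t k.+1 0 0) ^+ 2)%R])%E
  /\
  forall (L2bar : R)
    (fbar : T -> nat -> 'rV[R]_n -> 'rV[R]_n -> 'rV[R]_n)
    (ybar : nat -> T -> 'rV[R]_n),
  assumption_B w rho L2bar fbar ->
  BSDeltaE_solution w rho fbar ybar ->
  (\sum_(0 <= k <oo) (expR (- (rho * k%:R)))%:E
       * 'E_P[fun t => (enorm (y k t - ybar k t) ^+ 2)%R]
   <= C%:E * \sum_(0 <= k <oo) (expR (- (rho * k.+1%:R)))%:E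
       * 'E_P[fun t =>
           (enorm (f t k.+1 (yprime w ybar k t) (zprime w ybar k t)
                   - fbar t k.+1 (yprime w ybar k t) (zprime w ybar k t))
              ^+ 2)%R])%E.
Proof.
have L1 : 6 * L2 ^+ 2 * expR rho < 1.
  have L0 : 0 < 6 * L2 ^+ 2 by rewrite mulr_gt0// exprn_gt0.
  rewrite -[ltRHS](expRxMexpNx_1 (ln (6 * L2 ^+ 2))) lnK ?posrE// ltr_pM2l//.
  by rewrite ltr_expR.
exists (3 * expR rho / (1 - 6 * L2 ^+ 2 * expR rho)); split.
  by rewrite divr_gt0 ?subr_gt0// mulr_gt0// expR_gt0.
move=> d T P w n f y _ noise [_ _ _ fL] [yL _ yE]; split.
  apply: (backward_estimate noise L2 y (yprime w y) (zprime w y)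
    (fun k t => f t k.+1 0 0)) => //.
  - exact: L2rho_measurable yL.
  - exact: L2rho_discounted_sum yL.
  - by move=> k i; exact: (yprime_cond_exp k i yL).
  - by move=> k i; exact: (zprime_cond_exp noise k i yL).
  move=> k; apply: filterS2 (yE k) (fL k) => t -> ft.
  by have := ft (yprime w y k t) (zprime w y k t) 0 0; rewrite !subr0.
move=> L2bar fbar ybar _ [ybL _ ybE].
have my := L2rho_measurable yL; have myb := L2rho_measurable ybL.
apply: (backward_estimate noise L2 (fun k t => y k t - ybar k t)
  (fun k t => yprime w y k t - yprime w ybar k t)
  (fun k t => zprime w y k t - zprime w ybar k t)
  (fun k t => f t k.+1 (yprime w ybar k t) (zprime w ybar k t)
    - fbar t k.+1 (yprime w ybar k t) (zprime w ybar k t))) => //.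
- move=> k i; under eq_fun do rewrite !mxE; exact: measurable_funB.
- exact: (L2rho_discounted_sum_sub yL ybL).
- move=> k i.
  have := is_cond_exp_linear (past_sub_measurable (w := w) (k := k)) 1 (- 1)
    (L2rho_integrable k.+1 i yL) (L2rho_integrable k.+1 i ybL)
    (yprime_cond_exp k i yL) (yprime_cond_exp k i ybL).
  by congr (is_cond_exp _ _ _ _); apply/funext => t; rewrite !mxE mul1r mulN1r.
- move=> k i.
  have iw := noise_sqr_integrable noise k.
  have mw : measurable_fun [set: T] (w k) by [].
  have := is_cond_exp_linear (past_sub_measurable (w := w) (k := k)) 1 (- 1)
    (L2rho_integrable_mul (w k) k.+1 i yL mw iw)
    (L2rho_integrable_mul (w k) k.+1 i ybL mw iw)
    (zprime_cond_exp noise k i yL) (zprime_cond_exp noise k i ybL).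
  by congr (is_cond_exp _ _ _ _); apply/funext => t; rewrite !mxE mul1r mulN1r ?mulrBr.
move=> k; apply: filterS3 (yE k) (ybE k) (fL k) => t yt ybt ft.
have := ft (yprime w y k t) (zprime w y k t) (yprime w ybar k t) (zprime w ybar k t).
by rewrite -yt -ybt opprB addrA subrK.
Qed.
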